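(* Let $u\in\mathbb{V}_7\setminus\mathbb{R}e_1$ be a unit vector and set $\alpha=\langle u,e_1\rangle$. Then the plane $\Pi_u:=\mathrm{Span}_{\mathbb{R}}\{e_1,u\}$ is a subalgebra of $\mathbb{V}_7$ isomorphic to $\mathbb{C}$. The multiplication on $\Pi_u$ is given, for $a_1,a_2,b_1,b_2\in\mathbb{R}$, by $$(a_1e_1+a_2u)\veebar_7(b_1e_1+b_2u)=(a_1b_1-a_2b_2)\,e_1+(a_1b_2+a_2b_1+2\alpha\,a_2b_2)\,u,$$ and the $\mathbb{R}$-linear map $\varphi:\Pi_u\to\mathbb{C}$ with $\varphi(e_1)=1$, $\varphi(u)=\eta$, where $\eta\in\mathbb{C}$ satisfies $\eta^2=-1+2\alpha\eta$, is an isomorphism of algebras. When $u\perp e_1$ this reduces (with $\eta=i$) to the identification $e_1\mapsto 1$, $u\mapsto i$.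
   Context: Let $\{e_1,\dots,e_7\}$ be the standard orthonormal basis of $\mathbb{R}^7$ with Euclidean inner product $\langle\cdot,\cdot\rangle$, dual basis $\omega^1,\dots,\omega^7$, and $\omega^{ijk}=\omega^i\wedge\omega^j\wedge\omega^k$. Let $$\Phi=\omega^{123}+\omega^{145}+\omega^{167}+\omega^{246}-\omega^{257}-\omega^{347}-\omega^{356},$$ and let $\times$ be the bilinear cross product on $\mathbb{R}^7$ characterized by $\langle u\times v,w\rangle=\Phi(u,v,w)$ for all $u,v,w$. The exceptional Vidinli algebra $\mathbb{V}_7=(\mathbb{R}^7,\veebar_7)$ has the bilinear product $$a\veebar_7 b=\langle a,e_1\rangle b+\langle b,e_1\rangle a-\langle a,b\rangle e_1+\langle e_1,a\times b\rangle e_1 .$$ *)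

(* Defs.v *)
From HB Require Import structures.
From mathcomp Require Import all_boot all_order all_algebra.
From mathcomp Require Import reals complex ring.

Set Implicit Arguments.
Unset Strict Implicit.
Unset Printing Implicit Defensive.

Import Order.TTheory GRing.Theory Num.Theory.
Local Open Scope ring_scope.

Section Algebras.
Variable R : realType.

(* Not necessarily associative algebras are given by a carrier and its
   product; MathComp's algebra structures would impose associativity. *)
Definition bilinear_product (A : lmodType R) (mul : A -> A -> A) : Prop :=
  (forall a, linear (mul a)) /\ (forall b, linear (mul^~ b)).

Definition is_subalgebra (A : vectType R) (mul : A -> A -> A)
  (U : {vspace A}) : Prop := {in U &, forall a b, mul a b \in U}.

(* vsproj U is the identity on U, so this is the restriction of mul to U
   as soon as U is a subalgebra. *)
Definition submul (A : vectType R) (mul : A -> A -> A) (U : {vspace A})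
  (a b : subvs_of U) : subvs_of U := vsproj U (mul (vsval a) (vsval b)).

Lemma vsval_submul (A : vectType R) (mul : A -> A -> A) (U : {vspace A})
    (a b : subvs_of U) : is_subalgebra mul U ->
  vsval (submul mul a b) = mul (vsval a) (vsval b).
Proof. by move=> Umul; rewrite vsprojK // Umul ?subvsP. Qed.

Definition is_alg_iso (A B : lmodType R) (mulA : A -> A -> A)
  (mulB : B -> B -> B) (f : {linear A -> B}) : Prop :=
  bijective f /\ {morph f : a b / mulA a b >-> mulB a b}.

Definition alg_isomorphic (A B : lmodType R) (mulA : A -> A -> A)
  (mulB : B -> B -> B) : Prop :=
  exists f : {linear A -> B}, is_alg_iso mulA mulB f.

End Algebras.

Section Vidinli.
Variable R : realType.
Implicit Types u v w a b : 'rV[R]_7.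

Definition dotp u v : R := \sum_(i < 7) u 0 i * v 0 i.

(* The norm `|u| of the library on row vectors is the sup norm. *)
Definition enorm u : R := Num.sqrt (dotp u u).

(* Indices run from 1 to 7. *)
Definition e_ (k : nat) : 'rV[R]_7 := delta_mx 0 (inord k.-1).
Definition omega (k : nat) v : R := dotp (e_ k) v.

Definition wedge3 (f g h : 'rV[R]_7 -> R) u v w : R :=
  \det (\matrix_(p < 3, q < 3)
    (tnth [tuple f; g; h] p) (tnth [tuple u; v; w] q)).

Definition omega3 (i j k : nat) u v w : R :=
  wedge3 (omega i) (omega j) (omega k) u v w.

Definition Phi u v w : R :=
  omega3 1 2 3 u v w + omega3 1 4 5 u v w + omega3 1 6 7 u v w
  + omega3 2 4 6 u v w - omega3 2 5 7 u v w - omega3 3 4 7 u v w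
  - omega3 3 5 6 u v w.

(* The vector representing Phi u v; see dotp_cross and cross_unique. *)
Definition cross u v : 'rV[R]_7 := \row_(k < 7) Phi u v (delta_mx 0 k).

Definition vidinli a b : 'rV[R]_7 :=
  dotp a (e_ 1) *: b + dotp b (e_ 1) *: a - dotp a b *: e_ 1
  + dotp (e_ 1) (cross a b) *: e_ 1.

Definition plane u : {vspace 'rV[R]_7} := <<[:: e_ 1; u]>>%VS.

(* Rcomplex R is R[i] seen as an algebra over R. *)
Definition is_iso_with_values u (z : Rcomplex R)
  (phi : {linear subvs_of (plane u) -> Rcomplex R}) : Prop :=
  [/\ phi (vsproj (plane u) (e_ 1)) = 1,
      phi (vsproj (plane u) u) = z
    & is_alg_iso (submul vidinli (U := plane u)) *%R phi].

Lemma dotpC u v : dotp u v = dotp v u.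
Proof. by apply: eq_bigr => i _; rewrite mulrC. Qed.

Lemma dotpDr u v w : dotp u (v + w) = dotp u v + dotp u w.
Proof. by rewrite -big_split; apply: eq_bigr => i _; rewrite mxE mulrDr. Qed.

Lemma dotpZr (c : R) u v : dotp u (c *: v) = c * dotp u v.
Proof. by rewrite mulr_sumr; apply: eq_bigr => i _; rewrite mxE mulrCA. Qed.

Lemma dotp_linear u : linear (dotp u : 'rV[R]_7 -> R^o).
Proof. by move=> c v w; rewrite dotpDr dotpZr. Qed.

Lemma dotp_delta u (k : 'I_7) : dotp u (delta_mx 0 k) = u 0 k.
Proof.
rewrite /dotp (bigD1 k) //= mxE !eqxx mulr1 big1 ?addr0 // => i /negPf ik.
by rewrite mxE ik andbF mulr0.
Qed.

Lemma omegaE (k : nat) v : omega k v = v 0 (inord k.-1).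
Proof. by rewrite /omega dotpC dotp_delta. Qed.

Lemma wedge3E f g h u v w :
  wedge3 f g h u v w =
    f u * (g v * h w - g w * h v) - f v * (g u * h w - g w * h u)
    + f w * (g u * h v - g v * h u).
Proof.
rewrite /wedge3 (expand_det_row _ ord0) !big_ord_recl big_ord0 /cofactor.
rewrite !(expand_det_row _ ord0) !big_ord_recl !big_ord0 /cofactor !det_mx11.
by rewrite !mxE !(tnth_nth f) !(tnth_nth u) /=; ring.
Qed.

Lemma omega_linear k : linear (omega k : 'rV[R]_7 -> R^o).
Proof. exact: dotp_linear. Qed.

Lemma Phi_linear3 u v : linear (Phi u v : 'rV[R]_7 -> R^o).
Proof.
move=> c w1 w2; rewrite /Phi /omega3 !wedge3E !omega_linear /=.
by rewrite /GRing.scale /=; ring.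
Qed.

Lemma PhiC12 u v w : Phi u v w = - Phi v u w.
Proof. by rewrite /Phi /omega3 !wedge3E; ring. Qed.

Lemma PhiC23 u v w : Phi u v w = - Phi u w v.
Proof. by rewrite /Phi /omega3 !wedge3E; ring. Qed.

Lemma dotp_cross u v w : dotp (cross u v) w = Phi u v w.
Proof.
pose F : {linear 'rV[R]_7 -> R^o} := HB.pack (Phi u v : 'rV[R]_7 -> R^o)
  (GRing.isLinear.Build _ _ _ _ _ (Phi_linear3 u v)).
rewrite [w in RHS]row_sum_delta -[RHS]/(F _) linear_sum.
by apply: eq_bigr => k _; rewrite linearZ_LR mxE [LHS]mulrC.
Qed.

Lemma cross_unique u v x :
  (forall w, dotp x w = Phi u v w) -> x = cross u v.
Proof.
by move=> xP; apply/rowP => k; rewrite -!dotp_delta xP dotp_cross.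
Qed.

Lemma cross_linear2 u : linear (cross u).
Proof.
move=> c v w; apply/rowP => k.
rewrite !mxE [LHS]PhiC23 Phi_linear3 (PhiC23 _ v) (PhiC23 _ w).
by rewrite /GRing.scale /=; ring.
Qed.

Lemma crossC u v : cross u v = - cross v u.
Proof. by apply/rowP => k; rewrite !mxE PhiC12. Qed.

Lemma vidinli_bilinear : bilinear_product vidinli.
Proof.
have dl a c x y : dotp (c *: x + y) a = c * dotp x a + dotp y a.
  by rewrite dotpC dotp_linear -!(dotpC a).
have cl a c x y : cross (c *: x + y) a = c *: cross x a + cross y a.
  by rewrite crossC cross_linear2 (crossC x) (crossC y) scalerN opprD.
split=> [a c x y|b c x y]; apply/rowP => i; rewrite /vidinli.
  by rewrite cross_linear2 !dl !dotp_linear !mxE /GRing.scale /=; ring.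
by rewrite cl !dl !dotp_linear !mxE /GRing.scale /=; ring.
Qed.

End Vidinli.

Arguments e_ {R} k.

(* Main.v *)
Require Import Defs.
From HB Require Import structures.
From mathcomp Require Import all_boot all_order all_algebra.
From mathcomp Require Import reals complex.
From mathcomp Require Import ring lra.

Import Order.TTheory GRing.Theory Num.Theory.
Local Open Scope ring_scope.
Local Open Scope complex_scope.

(** In the product of a vector with itself, or of e_1 with any vector, the
    term <e_1, a x b> vanishes because Phi is alternating.  What remains says
    that e_1 is a two-sided identity ([vidinli_e1l], [vidinli_e1r]) and that
    every v satisfies v v = 2 <v, e_1> v - <v, v> e_1 ([vidinli_sqr]).  For a
    unit vector u this is the quadratic relation u^2 = 2 alpha u - e_1, so by
    bilinearity the plane spanned by e_1 and u is closed under the product,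
    with the stated multiplication rule ([vidinli_plane]): the plane is the
    quotient of R[X] by X^2 - 2 alpha X + 1.

    As u is a unit vector off the line of e_1, the strict Cauchy-Schwarz
    inequality gives alpha^2 < 1 ([dotp_unit_lt1]), that is, the polynomial
    has negative discriminant.  It therefore has roots eta in C, all of them
    nonreal ([quadratic_root_exists], [quadratic_root_nonreal]).  The map
    a e_1 + b u |-> a + b eta is multiplicative because eta satisfies the same
    relation as u ([plane_evalM]), and bijective because (1, eta) is a basis of
    C over R when eta is nonreal ([plane_eval_bij]).  It is the only linear map
    with the prescribed values because e_1 and u span the plane
    ([plane_eval_unique]). *)

(** * The Euclidean and cross products *)

Lemma dotp_ge0 {R : realType} (v : 'rV[R]_7) : 0 <= dotp v v.
Proof. by apply: sumr_ge0 => i _; rewrite -expr2 sqr_ge0. Qed.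

Lemma dotp0 {R : realType} (v : 'rV[R]_7) : dotp v 0 = 0.
Proof. by rewrite /dotp big1 // => i _; rewrite mxE mulr0. Qed.

Lemma dotp_eq0 {R : realType} (v : 'rV[R]_7) : (dotp v v == 0) = (v == 0).
Proof.
apply/eqP/eqP => [v0|->]; last exact: dotp0.
apply/rowP => i; rewrite mxE; apply/eqP; rewrite -sqrf_eq0 expr2; apply/eqP.
by apply: (psumr_eq0P _ v0) => // j _; rewrite -expr2 sqr_ge0.
Qed.

Lemma dotp_e1 {R : realType} : dotp (e_ 1) (e_ 1) = 1 :> R.
Proof. by rewrite dotp_delta mxE !eqxx. Qed.

Lemma enorm1_dotp {R : realType} {u : 'rV[R]_7} : enorm u = 1 -> dotp u u = 1.
Proof. by move=> u1; rewrite -(sqr_sqrtr (dotp_ge0 u)) -/(enorm u) u1 expr1n. Qed.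

Lemma cross_self {R : realType} (v : 'rV[R]_7) : cross v v = 0.
Proof.
apply/rowP => k; rewrite !mxE.
by have := PhiC12 v v (delta_mx 0 k); lra.
Qed.

(** Phi is alternating, so v x w is orthogonal to both of its factors. *)
Lemma dotp_crossl {R : realType} (v w : 'rV[R]_7) : dotp v (cross v w) = 0.
Proof.
by rewrite dotpC dotp_cross PhiC23 -dotp_cross cross_self dotpC dotp0 oppr0.
Qed.

Lemma dotp_crossr {R : realType} (v w : 'rV[R]_7) : dotp v (cross w v) = 0.
Proof. by rewrite crossC -scaleN1r dotpZr dotp_crossl mulr0. Qed.

(** * The Vidinli product on a plane through e_1 *)

Lemma vidinli_e1l {R : realType} (b : 'rV[R]_7) : vidinli (e_ 1) b = b.
Proof.
by rewrite /vidinli dotp_crossl dotp_e1 (dotpC (e_ 1)) scale1r scale0r addr0 addrK.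
Qed.

Lemma vidinli_e1r {R : realType} (a : 'rV[R]_7) : vidinli a (e_ 1) = a.
Proof.
by rewrite /vidinli dotp_crossr dotp_e1 scale1r scale0r addr0 addrAC subrr add0r.
Qed.

(** The cross product of v with itself vanishes, which leaves a quadratic
    relation: every v generates, together with the identity e_1, a subspace of
    dimension at most two. *)
Lemma vidinli_sqr {R : realType} (v : 'rV[R]_7) :
  vidinli v v = (2 * dotp v (e_ 1)) *: v - dotp v v *: e_ 1.
Proof.
rewrite /vidinli cross_self dotp0 scale0r addr0.
by rewrite -scalerDl mulr_natl mulr2n.
Qed.

(** By bilinearity, the rule follows from the four products of e_1 and u: e_1 is
    the identity, and u u = 2 alpha u - e_1. *)
Lemma vidinli_plane {R : realType} (u : 'rV[R]_7) (a1 a2 b1 b2 : R) :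
  dotp u u = 1 ->
  vidinli (a1 *: e_ 1 + a2 *: u) (b1 *: e_ 1 + b2 *: u) =
  (a1 * b1 - a2 * b2) *: e_ 1
  + (a1 * b2 + a2 * b1 + 2 * dotp u (e_ 1) * (a2 * b2)) *: u.
Proof.
move=> u1; have [linr linl] := vidinli_bilinear R.
have vl (x : 'rV[R]_7) : {morph (fun y => vidinli y x) : y z / y + z}.
  by move=> y z; have := linl x 1 y z; rewrite !scale1r.
have vr (x : 'rV[R]_7) : {morph vidinli x : y z / y + z}.
  by move=> y z; have := linr x 1 y z; rewrite !scale1r.
have v0l (x : 'rV[R]_7) : vidinli 0 x = 0.
  by apply: (addrI (vidinli 0 x)); rewrite -vl !addr0.
have v0r (x : 'rV[R]_7) : vidinli x 0 = 0.
  by apply: (addrI (vidinli x 0)); rewrite -vr !addr0.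
have vZl c (x y : 'rV[R]_7) : vidinli (c *: x) y = c *: vidinli x y.
  by have := linl y c x 0; rewrite /= !addr0 v0l addr0.
have vZr c (x y : 'rV[R]_7) : vidinli x (c *: y) = c *: vidinli x y.
  by have := linr x c y 0; rewrite /= !addr0 v0r addr0.
rewrite vl !vr !vZl !vZr !vidinli_e1l vidinli_e1r vidinli_sqr u1.
by apply/rowP => i; rewrite !mxE; ring.
Qed.

(** Strict Cauchy-Schwarz: the component w of u orthogonal to e_1 is nonzero,
    and its squared length is 1 - <u, e_1>^2. *)
Lemma dotp_unit_lt1 {R : realType} {u : 'rV[R]_7} :
  u \notin <[e_ 1]>%VS -> dotp u u = 1 -> dotp u (e_ 1) ^+ 2 < 1.
Proof.
move=> une u1; set c := dotp u (e_ 1); set w := u - c *: e_ 1.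
have w0 : w != 0.
  by apply: contraNneq une => /subr0_eq ->; rewrite memvZ // memv_line.
have dotpw x : dotp x w = dotp x u - c * dotp x (e_ 1).
  by rewrite /w -scaleNr dotpDr dotpZr mulNr.
have ww : dotp w w = 1 - c ^+ 2.
  by rewrite dotpw !(dotpC w) !dotpw u1 dotp_e1 (dotpC _ u) -/c; ring.
by rewrite -subr_gt0 -ww lt_def dotp_eq0 w0 dotp_ge0.
Qed.

(** * Roots of X^2 - 2 alpha X + 1 *)

(** A real root x would give (x - alpha)^2 = alpha^2 - 1 < 0. *)
Lemma quadratic_root_nonreal {R : realType} {alpha : R} {eta : R[i]} :
  alpha ^+ 2 < 1 -> eta ^+ 2 = -1 + 2 * alpha%:C * eta -> complex.Im eta != 0.
Proof.
case: eta => x y alpha_lt1 etaE; apply/eqP => /= y0.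
move: etaE; rewrite {}y0 complexr0.
rewrite -(rmorph_nat (real_complex R)) -(rmorph1 (real_complex R)) -rmorphN.
rewrite -!rmorphM -rmorphXn -rmorphD => /complexI.
by have := sqr_ge0 (x - alpha); lra.
Qed.

(** Completing the square, (eta - alpha)^2 = -(1 - alpha^2). *)
Lemma quadratic_root_exists {R : realType} {alpha : R} : alpha ^+ 2 < 1 ->
  exists eta : R[i], eta ^+ 2 = -1 + 2 * alpha%:C * eta.
Proof.
move=> alpha_lt1; pose s := Num.sqrt (1 - alpha ^+ 2).
have s2 : s ^+ 2 = 1 - alpha ^+ 2 by rewrite sqr_sqrtr // subr_ge0 ltW.
exists (alpha%:C + 'i%C * s%:C).
have : s%:C ^+ 2 = 1 - alpha%:C ^+ 2 :> R[i].
  by rewrite -rmorphXn s2 rmorphB rmorph1 rmorphXn.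
have := sqr_i R; move: ('i%C : R[i]) => i i2 sC2.
rewrite sqrrD exprMn i2 sC2; ring.
Qed.

(** * The isomorphism with the complex numbers *)

(** Turns the R-linear structure of C into ring operations, so that identities
    mixing scalars and products become ring identities. *)
Lemma Rcomplex_scaleE {R : realType} (c : R) (z : Rcomplex R) :
  c *: z = (c%:C : Rcomplex R) * z.
Proof.
by case: z => x y; apply/eqP; rewrite eq_complex /= !mul0r subr0 addr0 !eqxx.
Qed.

Section Plane.
Context {R : realType} {u : 'rV[R]_7}.
Hypotheses (une : u \notin <[e_ 1]>%VS) (u1 : dotp u u = 1).

Let B : 2.-tuple 'rV[R]_7 := [tuple e_ 1; u].

Lemma plane_free : free B.
Proof.
rewrite (perm_free (permEl (perm_catC [:: e_ 1] [:: u]))) /= free_cons span_seq1 une.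
rewrite seq1_free -dotp_eq0 dotp_e1; exact: oner_neq0.
Qed.

Lemma dim_plane : \dim (plane u) = 2%N.
Proof. by move: plane_free; rewrite /free => /eqP. Qed.

Lemma mem_plane a b : a *: e_ 1 + b *: u \in plane u.
Proof.
by rewrite rpredD // rpredZ // memv_span // !inE eqxx ?orbT.
Qed.

Definition plane_vec (a b : R) : subvs_of (plane u) :=
  vsproj (plane u) (a *: e_ 1 + b *: u).

Lemma plane_vecE a b :
  plane_vec a b = a *: vsproj (plane u) (e_ 1) + b *: vsproj (plane u) u.
Proof. by rewrite /plane_vec linearD !linearZ. Qed.

Let coord_e1 (v : subvs_of (plane u)) : R := coord B ord0 (vsval v).
Let coord_u (v : subvs_of (plane u)) : R := coord B (lift ord0 ord0) (vsval v).

Lemma plane_coordE v : vsval v = coord_e1 v *: e_ 1 + coord_u v *: u.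
Proof.
by rewrite {1}(coord_span (subvsP v)) !big_ord_recl big_ord0 addr0.
Qed.

Lemma plane_vecK v : v = plane_vec (coord_e1 v) (coord_u v).
Proof. by rewrite /plane_vec -plane_coordE vsvalK. Qed.

Lemma coord_plane_vec a b : (coord_e1 (plane_vec a b) = a) * (coord_u (plane_vec a b) = b).
Proof.
rewrite /coord_e1 /coord_u /plane_vec vsprojK ?mem_plane //.
have -> : a *: e_ 1 + b *: u = \sum_(i < 2) tnth [tuple a; b] i *: B`_i.
  by rewrite !big_ord_recl big_ord0 addr0.
by rewrite !coord_sum_free ?plane_free.
Qed.

Lemma plane_subalgebra : is_subalgebra (@vidinli R) (plane u).
Proof.
move=> a b /vsprojK <- /vsprojK <-.
by rewrite !plane_coordE vidinli_plane // mem_plane.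
Qed.

Lemma submul_plane_vec a1 a2 b1 b2 :
  submul (@vidinli R) (U := plane u) (plane_vec a1 a2) (plane_vec b1 b2) =
  plane_vec (a1 * b1 - a2 * b2)
    (a1 * b2 + a2 * b1 + 2 * dotp u (e_ 1) * (a2 * b2)).
Proof. by rewrite /submul !vsprojK ?mem_plane // vidinli_plane. Qed.

Section Iso.
Context {eta : Rcomplex R}.

Definition plane_eval (v : subvs_of (plane u)) : Rcomplex R :=
  coord_e1 v *: 1 + coord_u v *: eta.

Fact plane_eval_is_linear : linear plane_eval.
Proof.
move=> k v w; rewrite /plane_eval /coord_e1 /coord_u !linearP /=.
by rewrite !scalerDl !scalerA (mulrC k (coord B ord0 _)) addrACA.
Qed.

HB.instance Definition _ :=
  GRing.isLinear.Build R (subvs_of (plane u)) (Rcomplex R) _ plane_eval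
    plane_eval_is_linear.

Lemma plane_eval_vec a b :
  plane_eval (plane_vec a b) = a *: 1 + b *: eta.
Proof. by rewrite /plane_eval !coord_plane_vec. Qed.

(** Reading a + b eta = z on real and imaginary parts, b is forced by
    b Im eta = Im z, and then a = Re z - b Re eta. *)
Lemma plane_eval_bij : complex.Im eta != 0 -> bijective plane_eval.
Proof.
move=> eta0; pose t (z : R[i]) := complex.Im z / complex.Im eta.
pose g z := plane_vec (complex.Re z - t z * complex.Re eta) (t z).
have evalE a b : plane_eval (plane_vec a b) =
    Complex (a + b * complex.Re eta) (b * complex.Im eta).
  rewrite plane_eval_vec; case: (eta) => x y.
  by apply/eqP; rewrite eq_complex /= mulr1 mulr0 add0r !eqxx.
exists g => [v|[x y]]; last by rewrite evalE /t /= divfK // subrK.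
by rewrite [v]plane_vecK /g evalE /t /= mulfK // addrK.
Qed.

Lemma plane_eval_unique (psi : {linear subvs_of (plane u) -> Rcomplex R}) :
  psi (vsproj (plane u) (e_ 1)) = 1 -> psi (vsproj (plane u) u) = eta ->
  psi =1 plane_eval.
Proof.
move=> psi1 psiu v; rewrite [v]plane_vecK plane_eval_vec.
by rewrite plane_vecE linearD !linearZ_LR psi1 psiu.
Qed.

(** After expansion, both sides differ by a multiple of the relation satisfied by
    eta, the same relation that u satisfies. *)
Lemma plane_evalM :
  (eta : R[i]) ^+ 2 = -1 + 2 * (dotp u (e_ 1))%:C * eta ->
  {morph plane_eval : a b / submul (@vidinli R) (U := plane u) a b >-> a * b}.
Proof.
move=> etaE a b; rewrite [a]plane_vecK [b]plane_vecK submul_plane_vec.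
rewrite !plane_eval_vec.
rewrite !Rcomplex_scaleE !(rmorphB, rmorphD, rmorphM, rmorph_nat).
have quad (S : comNzRingType) (x y z w t s : S) : s ^+ 2 = -1 + 2 * t * s ->
    (x * y - z * w) * 1 + (x * w + z * y + 2 * t * (z * w)) * s =
    (x * 1 + z * s) * (y * 1 + w * s).
  by move=> sE; ring: sE.
exact: quad etaE.
Qed.

Lemma plane_iso : (eta : R[i]) ^+ 2 = -1 + 2 * (dotp u (e_ 1))%:C * eta ->
  exists2 phi : {linear subvs_of (plane u) -> Rcomplex R},
    is_iso_with_values eta phi
    & forall psi : {linear subvs_of (plane u) -> Rcomplex R},
        psi (vsproj (plane u) (e_ 1)) = 1 ->
        psi (vsproj (plane u) u) = eta -> psi =1 phi.
Proof.
move=> etaE; have eta_im := quadratic_root_nonreal (dotp_unit_lt1 une u1) etaE.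
have eval_e1 : plane_eval (vsproj (plane u) (e_ 1)) = 1.
  have -> : vsproj (plane u) (e_ 1) = plane_vec 1 0.
    by rewrite plane_vecE scale1r scale0r addr0.
  by rewrite plane_eval_vec scale1r scale0r addr0.
have eval_u : plane_eval (vsproj (plane u) u) = eta.
  have -> : vsproj (plane u) u = plane_vec 0 1.
    by rewrite plane_vecE scale1r scale0r add0r.
  by rewrite plane_eval_vec scale1r scale0r add0r.
exists (plane_eval : {linear subvs_of (plane u) -> Rcomplex R}).
  by split=> //; split; [exact: plane_eval_bij | exact: plane_evalM].
exact: plane_eval_unique.
Qed.
End Iso.
End Plane.

Theorem proposition3p7 (R : realType) (u : 'rV[R]_7)
  (hne : u \notin <[e_ 1]>%VS) (hunit : enorm u = 1) :
  let alpha : R := dotp u (e_ 1) in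
  [/\ \dim (plane u) = 2%N,
      is_subalgebra (@vidinli R) (plane u)
      /\ alg_isomorphic (submul (@vidinli R) (U := plane u))
           (@GRing.mul (Rcomplex R)),
      forall a1 a2 b1 b2 : R,
        vidinli (a1 *: e_ 1 + a2 *: u) (b1 *: e_ 1 + b2 *: u) =
        (a1 * b1 - a2 * b2) *: e_ 1
        + (a1 * b2 + a2 * b1 + 2 * alpha * (a2 * b2)) *: u,
      (exists eta : R[i], eta ^+ 2 = -1 + 2 * alpha%:C * eta)
      /\ (forall eta : R[i], eta ^+ 2 = -1 + 2 * alpha%:C * eta ->
          exists2 phi : {linear subvs_of (plane u) -> Rcomplex R},
            is_iso_with_values eta phi
            & forall psi : {linear subvs_of (plane u) -> Rcomplex R},
                psi (vsproj (plane u) (e_ 1)) = 1 ->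
                psi (vsproj (plane u) u) = eta -> psi =1 phi)
    & alpha = 0 ->
      [/\ 'i%C ^+ 2 = -1 + 2 * alpha%:C * 'i%C :> R[i],
          (forall a1 a2 b1 b2 : R,
            vidinli (a1 *: e_ 1 + a2 *: u) (b1 *: e_ 1 + b2 *: u) =
            (a1 * b1 - a2 * b2) *: e_ 1 + (a1 * b2 + a2 * b1) *: u)
        & exists2 phi : {linear subvs_of (plane u) -> Rcomplex R},
            is_iso_with_values 'i%C phi
            & forall psi : {linear subvs_of (plane u) -> Rcomplex R},
                psi (vsproj (plane u) (e_ 1)) = 1 ->
                psi (vsproj (plane u) u) = 'i%C -> psi =1 phi]].
Proof.
move=> alpha; have u1 := enorm1_dotp hunit.
have [eta etaE] := quadratic_root_exists (dotp_unit_lt1 hne u1).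
split.
- exact: dim_plane.
- split; first exact: plane_subalgebra.
  by have [phi [_ _ phi_iso] _] := plane_iso hne u1 etaE; exists phi.
- by move=> a1 a2 b1 b2; exact: vidinli_plane.
- by split=> [|z zE]; [exists eta | exact: plane_iso].
move=> alpha0.
have iE : 'i%C ^+ 2 = -1 + 2 * alpha%:C * 'i%C :> R[i].
  by rewrite alpha0 sqr_i mulr0 mul0r addr0.
split=> //; last exact: plane_iso.
move=> a1 a2 b1 b2.
by rewrite vidinli_plane // -/alpha alpha0 mulr0 mul0r addr0.
Qed.
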